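(* Let $P$ be a family of transition probabilities on $A\times\underline{A}$ and $(\gamma_m)_{m\ge0}$ a real sequence decreasing monotonically to $0$ with $\gamma_0<1$, such that for every $a\in A$ and $m\ge0$, $$\inf_{x,y\,:\,x\stackrel{m}{=}y}\frac{P(a\mid x)}{P(a\mid y)}\;\ge\;1-\gamma_m .$$ For each history $x$ let $(Z^x_n)_{n\in\mathbb{Z}}$ be the chain with past $x$ and transitions $P$. Then for all histories $x,y\in\underline{A}$ there is a coupling $\big((\widetilde U^{x,y}_n,\widetilde V^{x,y}_n)\big)_{n\in\mathbb{Z}}$ of $(Z^x_n)_{n\in\mathbb{Z}}$ and $(Z^y_n)_{n\in\mathbb{Z}}$ such that the process $(T^{x,y}_n)_{n\in\mathbb{Z}}$ defined by $$T^{x,y}_n=\inf\{m\ge0:\widetilde U^{x,y}_{n-m}\ne\widetilde V^{x,y}_{n-m}\}$$ satisfies $$\mathbf{P}(T^{x,y}_n=0)\le\gamma^*_n\qquad\text{for all } n\ge0 .$$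
   Context: $A$ is a finite set and $\underline{A}=\{x=(x_j)_{j\le-1}:x_j\in A\}$ is the set of histories, with the product topology and $\sigma$-algebra. For $x,y\in\underline{A}$ and $m\ge0$, $x\stackrel{m}{=}y$ means $x_j=y_j$ for all $-m\le j\le-1$ (no condition if $m=0$). A family of transition probabilities on $A\times\underline{A}$ is a map $P:A\times\underline{A}\to[0,1]$, $(a,z)\mapsto P(a\mid z)$, with $\sum_{a\in A}P(a\mid z)=1$ for every $z$. The ratio condition is understood as $P(a\mid x)\ge(1-\gamma_m)P(a\mid y)$ whenever $x\stackrel{m}{=}y$. For $x\in\underline{A}$, the chain with past $x$ and transitions $P$ is the process $(Z^x_n)_{n\in\mathbb{Z}}$ with $Z^x_n=x_n$ for $n\le-1$ and, for $n\ge0$, $\mathbf{P}(Z^x_n=a\mid Z^x_{n+j}=z_j,\ j\le-1)=P(a\mid z)$ for all $a\in A$ and all histories $z$ with $z_{j-n}=x_j$, $j\le-1$. A coupling of two processes is a process of pairs, on one probability space, whose two marginal processes have the laws of the given processes. The infimum of the empty set is $+\infty$. $(S^{(\gamma)}_n)_{n\ge0}$ is the Markov chain on $\{0,1,2,\dots\}$ with $S^{(\gamma)}_0=0$ almost surely and transition probabilities $p_{i,i+1}=1-\gamma_i$, $p_{i,0}=\gamma_i$ for all $i\ge0$; $\gamma^*_n=\mathbf{P}(S^{(\gamma)}_n=0)$. *)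

(* Defs.v *)
From HB Require Import structures.
From mathcomp Require Import all_boot all_order all_algebra.
From mathcomp Require Import all_classical all_reals all_analysis.

Set Implicit Arguments.
Unset Strict Implicit.
Unset Printing Implicit Defensive.

Import Order.TTheory GRing.Theory Num.Theory.
Import numFieldNormedType.Exports.

Local Open Scope classical_set_scope.
Local Open Scope ring_scope.

(* A history x = (x_j)_{j <= -1} is stored as k |-> x_{-(k+1)}; note that
   -(k+1) is the integer [Negz k]. *)
Definition history (A : finType) : Type := nat -> A.

(* j = -(k+1) satisfies -m <= j <= -1 iff k < m. *)
Definition eq_past (A : finType) (m : nat) (x y : history A) : Prop :=
  forall k, (k < m)%N -> x k = y k.

(* [P a z] is P(a | z). *)
Definition transition_probabilities (R : realType) (A : finType)
    (P : A -> history A -> R) : Prop :=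
  (forall a z, 0 <= P a z <= 1) /\ (forall z, \sum_(a : A) P a z = 1).

(* P(E | F); only meaningful (and only used below) when P(F) > 0. *)
Definition cond_prob (R : realType) (d : measure_display)
    (Omega : measurableType d) (Pr : probability Omega R)
    (E F : set Omega) : R :=
  fine (Pr (E `&` F)) / fine (Pr F).

(* The state space is countable and carries its discrete sigma-algebra. *)
Definition is_process (d : measure_display) (Omega : measurableType d)
    (I T : Type) (X : I -> Omega -> T) : Prop :=
  forall (i : I) (B : set T), measurable (X i @^-1` B).

(* As usual, conditional probabilities are only prescribed given events of
   positive probability.  In terms of the encoding of histories,
   z_{j-n} = x_j for j = -(k+1) reads [z (n + k) = x k]. *)
Definition is_chain (R : realType) (A : finType) (P : A -> history A -> R)
    (x : history A) (d : measure_display) (Omega : measurableType d)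
    (Pr : probability Omega R) (Z : int -> Omega -> A) : Prop :=
  [/\ is_process Z,
      forall k : nat, {ae Pr, forall w, Z (Negz k) w = x k}
    & forall (n : nat) (a : A) (z : history A),
        (forall k : nat, z (n + k)%N = x k) ->
        let past := [set w | forall k : nat, Z (n%:Z + Negz k) w = z k] in
        (0 < Pr past)%E ->
        cond_prob Pr [set w | Z n%:Z w = a] past = P a z].

(* The product sigma-algebra on A^Z, A being discrete. *)
Definition path_measurable (A : finType) : set (set (int -> A)) :=
  <<s [set E | exists (n : int) (B : set A), E = [set u | B (u n)]] >>.

Definition same_law (R : realType) (A : finType)
    (d1 : measure_display) (Omega1 : measurableType d1)
    (Pr1 : probability Omega1 R) (X1 : int -> Omega1 -> A)
    (d2 : measure_display) (Omega2 : measurableType d2)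
    (Pr2 : probability Omega2 R) (X2 : int -> Omega2 -> A) : Prop :=
  forall E : set (int -> A), path_measurable E ->
    Pr1 [set w | E (fun n => X1 n w)] = Pr2 [set w | E (fun n => X2 n w)].

(* [(U, V)], on (Omega, Q), is a coupling of the processes X1 and X2. *)
Definition is_coupling (R : realType) (A : finType)
    (d1 : measure_display) (Omega1 : measurableType d1)
    (Pr1 : probability Omega1 R) (X1 : int -> Omega1 -> A)
    (d2 : measure_display) (Omega2 : measurableType d2)
    (Pr2 : probability Omega2 R) (X2 : int -> Omega2 -> A)
    (d : measure_display) (Omega : measurableType d)
    (Q : probability Omega R) (U V : int -> Omega -> A) : Prop :=
  [/\ is_process (fun (n : int) w => (U n w, V n w)),
      same_law Q U Pr1 X1
    & same_law Q V Pr2 X2].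

(* T_n = inf {m >= 0 : U_{n-m} <> V_{n-m}}, with values in [0, +oo];
   [ereal_inf set0 = +oo]. *)
Definition mismatch_time (R : realType) (A : finType) (Omega : Type)
    (U V : int -> Omega -> A) (n : int) (w : Omega) : \bar R :=
  ereal_inf [set (m%:R%:E : \bar R) |
             m in [set m : nat | U (n - m%:Z) w <> V (n - m%:Z) w]].

(* Markov chain on nat started at i0 with transition probabilities p. *)
Definition is_markov_chain (R : realType) (p : nat -> nat -> R) (i0 : nat)
    (d : measure_display) (Omega : measurableType d)
    (Pr : probability Omega R) (S : nat -> Omega -> nat) : Prop :=
  [/\ is_process S,
      {ae Pr, forall w, S 0%N w = i0}
    & forall (n : nat) (s : nat -> nat) (j : nat),
        let past := [set w | forall k : nat, (k <= n)%N -> S k w = s k] in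
        (0 < Pr past)%E ->
        cond_prob Pr [set w | S n.+1 w = j] past = p (s n) j].

(* p_{i,i+1} = 1 - gamma_i and p_{i,0} = gamma_i. *)
Definition renewal_trans (R : realType) (gamma : nat -> R) (i j : nat) : R :=
  if j == i.+1 then 1 - gamma i else if j == 0%N then gamma i else 0.

Definition gamma_star (R : realType) (d : measure_display)
    (Omega : measurableType d) (Pr : probability Omega R)
    (S : nat -> Omega -> nat) (n : nat) : \bar R :=
  Pr [set w | S n w = 0%N].

(* Main.v *)
(* Couple the two chains step by step, drawing the next pair of letters from
   the maximal coupling of the two current transition laws.  If the two pasts
   agree over the last m letters, the ratio condition makes the next letters
   agree with probability at least 1 - gamma_m, so the length of the current
   agreement dominates the renewal chain S stochastically: gamma being
   nonincreasing, the probability of being at 0 after a given number of steps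
   is a nonincreasing function of the starting state of S.

   The pair process lives on R with the uniform probability on [0, 1]: each
   finite word of pairs is realised by an interval whose length is the
   probability of the word, the intervals of the one-letter extensions of a
   word partitioning its own interval.  The marginals are identified by the
   fact that a chain with given past and transitions has only one law. *)

Require Import Defs.
From HB Require Import structures.
From mathcomp Require Import all_boot all_order all_algebra.
From mathcomp Require Import all_classical all_reals all_analysis.
From mathcomp Require Import measurable_realfun lra.

Set Implicit Arguments.
Unset Strict Implicit.
Unset Printing Implicit Defensive.

Import Order.TTheory GRing.Theory Num.Theory.
Import numFieldNormedType.Exports.

Local Open Scope classical_set_scope.
Local Open Scope ring_scope.

(** * Laws of chains *)

Section finite_valued.
Context (R : realType) (d : measure_display) (Omega : measurableType d)
  (Pr : probability Omega R).

Lemma measure_ae_eq (E F : set Omega) : measurable E -> measurable F ->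
  {ae Pr, forall w, E w <-> F w} -> Pr E = Pr F.
Proof.
move=> mE mF [N [mN N0 EFN]].
have EFC w : ~ N w -> E w <-> F w.
  by move=> Nw; apply: contrapT => EFw; apply: Nw; exact: EFN.
have PC G : measurable G -> Pr G = Pr (G `\` N).
  move=> mG; rewrite -[in LHS](setUIDK G N) measureU//.
  - rewrite (subset_measure0 _ _ (@subIsetr _ G N)) ?add0e//.
    exact: measurableI.
  - exact: measurableI.
  - exact: measurableD.
  - by apply/seteqP; split => w // [[_ ?] []].
rewrite PC// [RHS]PC//; congr (Pr _); apply/seteqP.
by split => w [? Nw]; split => //; apply/(EFC w Nw).
Qed.

Lemma finite_preimage_measurable (T : finType) (X : Omega -> T) :
  (forall t, measurable [set w | X w = t]) ->
  forall B : set T, measurable [set w | B (X w)].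
Proof.
move=> mX B.
rewrite [X in measurable X](_ : _ = \bigcup_(t in B) [set w | X w = t]).
  by apply: fin_bigcup_measurable.
by apply/seteqP; split=> [w Bw|w [t Bt /= ->]//]; exists (X w).
Qed.

Lemma measure_finite_partition (T : finType) (X : Omega -> T)
    (E : set Omega) :
  measurable E -> (forall t, measurable [set w | X w = t]) ->
  Pr E = (\sum_(t : T) Pr (E `&` [set w | X w = t]))%E.
Proof.
move=> mE mX.
have partial s : uniq s ->
    Pr (E `&` [set w | X w \in s]) =
    (\sum_(t <- s) Pr (E `&` [set w | X w = t]))%E.
  elim: s => [_|t s IH /= /andP[ts us]].
    by rewrite big_nil [X in Pr X](_ : _ = set0) ?measure0//; apply/seteqP; split => w [].
  rewrite big_cons -IH// -measureU//.
  - congr (Pr _); rewrite -setIUr; congr (_ `&` _); apply/seteqP; split => w /=.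
      by rewrite inE => /orP[/eqP|]; [left|right].
    by rewrite inE => -[->|->]; rewrite ?eqxx ?orbT.
  - exact: measurableI.
  - by apply: measurableI => //; exact: (finite_preimage_measurable mX [set t | t \in s]).
  - rewrite setIACA setIid [X in _ `&` X](_ : _ = set0) ?setI0//.
    by apply/seteqP; split => w //= [->]; rewrite (negbTE ts).
rewrite -(partial _ (index_enum_uniq T)); congr (Pr _).
by apply/seteqP; split=> [w Ew|w []//]; split => //=; rewrite mem_index_enum.
Qed.

End finite_valued.

Lemma finite_law_eq (R : realType) (d1 d2 : measure_display)
    (Omega1 : measurableType d1) (Omega2 : measurableType d2)
    (Pr1 : probability Omega1 R) (Pr2 : probability Omega2 R)
    (T : finType) (X1 : Omega1 -> T) (X2 : Omega2 -> T) :
  (forall t, measurable [set w | X1 w = t]) ->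
  (forall t, measurable [set w | X2 w = t]) ->
  (forall t, Pr1 [set w | X1 w = t] = Pr2 [set w | X2 w = t]) ->
  forall B : set T, Pr1 [set w | B (X1 w)] = Pr2 [set w | B (X2 w)].
Proof.
move=> mX1 mX2 eX B.
rewrite (measure_finite_partition _ _ mX1); last exact: finite_preimage_measurable.
rewrite (measure_finite_partition _ _ mX2); last exact: finite_preimage_measurable.
have atomE (Om : Type) (X : Om -> T) t : [set w | B (X w)] `&` [set w | X w = t] =
    if t \in B then [set w | X w = t] else set0.
  case: ifPn => [/set_mem Bt|/negP tB]; apply/seteqP; split=> w //.
  - by case.
  - by move=> /= ->.
  - by move=> [/= BX Xt]; apply: tB; rewrite inE -Xt.
by apply: eq_bigr => t _; rewrite !atomE; case: ifP; rewrite ?measure0.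
Qed.

(* The letters [Z_{n-1}, ..., Z_0], most recent first, matching the indexing
   of histories. *)
Fixpoint word (A : Type) (n : nat) (u : nat -> A) : seq A :=
  if n is n'.+1 then u n' :: word n' u else [::].

Lemma size_word (A : Type) n (u : nat -> A) : size (word n u) = n.
Proof. by elim: n => //= n ->. Qed.

Lemma nth_word (A : Type) (a : A) n (u : nat -> A) k :
  (k < n)%N -> nth a (word n u) k = u (n - k.+1)%N.
Proof.
elim: n k => // n IH [|k] /= kn; first by rewrite subn1.
by rewrite IH// subSS.
Qed.

Lemma map_word (A B : Type) (f : A -> B) n (u : nat -> A) :
  map f (word n u) = word n (f \o u).
Proof. by elim: n => //= n ->. Qed.

(** Both [s] and [x] are read backwards in time, so [s] is the most recent stretch of the past. The
    default [x 0] of [nth] is never reached; it only supplies an element of [A]. *)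
Definition prepend (A : finType) (s : seq A) (x : history A) : history A :=
  fun k => if (k < size s)%N then nth (x 0%N) s k else x (k - size s)%N.

Section process.
Context (d : measure_display) (Omega : measurableType d) (A : finType).
Implicit Types Z : int -> Omega -> A.

Lemma map_process_measurable Z (s : seq int) (B : set (seq A)) :
  is_process Z -> measurable [set w | B [seq Z i w | i <- s]].
Proof.
move=> pZ; elim: s B => [|i s IH] B /=.
  have [b|nb] := pselect (B [::]).
    by rewrite (_ : [set _ | _] = setT)//; apply/seteqP; split.
  by rewrite (_ : [set _ | _] = set0)//; apply/seteqP; split.
rewrite (_ : [set _ | _] = \bigcup_(a in [set: A])
    ([set w | Z i w = a] `&` [set w | B (a :: [seq Z j w | j <- s])])).
  apply: fin_bigcup_measurable => // a _; apply: measurableI.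
    exact: (pZ i [set a]).
  exact: (IH (fun t => B (a :: t))).
apply/seteqP; split=> [w Bw|w [a _ [<-]]//].
by exists (Z i w).
Qed.

Lemma word_process_measurable Z n (B : set (seq A)) :
  is_process Z -> measurable [set w | B (word n (fun k => Z k%:Z w))].
Proof.
move=> pZ; have := map_process_measurable (word n Posz) B pZ.
by under eq_set do rewrite map_word.
Qed.

End process.

Lemma addz_Negz (n k : nat) :
  (n%:Z + Negz k = if (k < n)%N then Posz (n - k.+1) else Negz (k - n))%R.
Proof.
rewrite NegzE; case: ltnP => kn; first by rewrite subzn.
by rewrite NegzE -subSn// -subzn ?opprB// leqW.
Qed.

Lemma prepend_cat (A : finType) n (z x : history A) :
  (forall k, z (n + k)%N = x k) -> prepend (mkseq z n) x = z.
Proof.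
move=> zx; apply/funext => k; rewrite /prepend size_mkseq.
by case: ltnP => kn; [rewrite nth_mkseq|rewrite -zx subnKC].
Qed.

(** On a path with past [x], the conditions at positions [k >= size s] hold automatically, so
    prescribing a whole history amounts to prescribing a finite word. *)
Lemma eq_word_prepend (A : finType) (x : history A) (u : int -> A) s :
  (forall k, u (Negz k) = x k) ->
  (forall k, u ((size s)%:Z + Negz k) = prepend s x k) <->
  word (size s) (u \o Posz) = s.
Proof.
move=> ux; split=> [us|us k].
  apply: (@eq_from_nth _ (x 0%N)); rewrite size_word// => k ks.
  by have := us k; rewrite addz_Negz /prepend ks nth_word.
rewrite addz_Negz /prepend; case: ltnP => ks; last exact: ux.
by rewrite -[in RHS]us nth_word.
Qed.

Section chain_words.
Context (R : realType) (A : finType) (P : A -> history A -> R)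
  (x : history A) (d : measure_display) (Omega : measurableType d)
  (Pr : probability Omega R) (Z : int -> Omega -> A).
Hypothesis pZ : is_process Z.
Hypothesis Zx : forall k : nat, {ae Pr, forall w, Z (Negz k) w = x k}.

Let past n (z : history A) :=
  [set w | forall k : nat, Z (n%:Z + Negz k) w = z k].

Lemma past_measurable n z : measurable (past n z).
Proof.
rewrite (_ : past n z = \bigcap_k [set w | Z (n%:Z + Negz k) w = z k]).
  by apply: bigcapT_measurable => k; exact: (pZ _ [set z k]).
by apply/seteqP; split=> w /= wz k; [move=> _|]; apply: wz.
Qed.

Lemma prob_past s : Pr (past (size s) (prepend s x)) =
  Pr [set w | word (size s) (fun k => Z k%:Z w) = s].
Proof.
apply: measure_ae_eq; first exact: past_measurable.
  exact: (word_process_measurable _ [set s]).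
have := ae_foralln Zx; apply: filterS => w Zw.
exact: (eq_word_prepend (u := Z^~ w) s Zw).
Qed.

Lemma prob_letter_past a s :
  Pr ([set w | Z (size s)%:Z w = a] `&` past (size s) (prepend s x)) =
  Pr [set w | word (size s).+1 (fun k => Z k%:Z w) = a :: s].
Proof.
apply: measure_ae_eq.
- apply: measurableI; first exact: (pZ _ [set a]).
  exact: past_measurable.
- exact: (word_process_measurable _ [set a :: s]).
have := ae_foralln Zx; apply: filterS => w Zw /=.
split=> [[<- /(eq_word_prepend (u := Z^~ w) s Zw) ws]|]; first by rewrite ws.
by move=> [-> ws]; split=> //; apply/(eq_word_prepend (u := Z^~ w) s Zw).
Qed.

(** Trades conditioning on an infinite past for a product formula on finite words: up to a null set,
    the past event is a word event. *)
Lemma is_chainP : is_chain P x Pr Z <->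
  forall a s,
    Pr [set w | word (size s).+1 (fun k => Z k%:Z w) = a :: s] =
    (Pr [set w | word (size s) (fun k => Z k%:Z w) = s] *
     (P a (prepend s x))%:E)%E.
Proof.
split=> [[_ _ chainZ] a s|wordZ].
  have sx k : prepend s x (size s + k)%N = x k.
    by rewrite /prepend ltnNge leq_addr/= addKn.
  have := chainZ (size s) a (prepend s x) sx.
  rewrite -prob_past -prob_letter_past /cond_prob.
  have mp := past_measurable (size s) (prepend s x).
  have ml : measurable [set w | Z (size s)%:Z w = a] by exact: (pZ _ [set a]).
  (* On a null past the conditional probability is not prescribed, but then both sides are 0. *)
  have [p0|pn0] := eqVneq (Pr (past (size s) (prepend s x))) 0%E.
    move=> _; rewrite p0 mul0e.
    apply: (subset_measure0 _ _ (@subIsetr _ _ _) p0) => //.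
    exact: measurableI.
  rewrite lt0e pn0 measure_ge0 => /(_ isT) <-.
  rewrite -[X in (X * _)%E]fineK ?fin_num_measure// -EFinM mulrC divfK.
    by rewrite fineK// fin_num_measure//; exact: measurableI.
  by rewrite fine_eq0// fin_num_measure.
split=> // n a z zx.
(* Every admissible [z] is [prepend s x], with [s] its first [n] letters. *)
move: (mkseq z n) (size_mkseq z n) (prepend_cat zx) => s <- <-.
rewrite /cond_prob /= -/(past _ _) => p0.
have mp := past_measurable (size s) (prepend s x).
rewrite prob_letter_past wordZ -prob_past fineM ?fin_num_measure//=.
by rewrite mulrAC divff ?mul1r// gt_eqF// fine_gt0// p0 ltey_eq fin_num_measure.
Qed.

End chain_words.

Lemma word_law (R : realType) (A : finType) (d1 d2 : measure_display)
    (Omega1 : measurableType d1) (Omega2 : measurableType d2)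
    (Pr1 : probability Omega1 R) (Pr2 : probability Omega2 R)
    (P : A -> history A -> R) (x : history A)
    (Z1 : int -> Omega1 -> A) (Z2 : int -> Omega2 -> A) :
  is_chain P x Pr1 Z1 -> is_chain P x Pr2 Z2 ->
  forall s,
    Pr1 [set w | word (size s) (fun k => Z1 k%:Z w) = s] =
    Pr2 [set w | word (size s) (fun k => Z2 k%:Z w) = s].
Proof.
move=> c1 c2; have [p1 x1 _] := c1; have [p2 x2 _] := c2.
elim=> [|a s IH]; last first.
  by rewrite (is_chainP P p1 x1).1// (is_chainP P p2 x2).1// IH.
have nilT (Om : Type) : [set w : Om | [::] = [::] :> seq A] = setT.
  by apply/seteqP; split.
by rewrite /= !nilT !probability_setT.
Qed.

(** Dynkin's argument: finite-dimensional cylinders are stable under intersection, and the events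
    with equal probabilities form a lambda-system. On a cylinder the past is almost surely [x], and
    [word_law] settles the remaining letters. *)
Lemma is_chain_same_law (R : realType) (A : finType) (d1 d2 : measure_display)
    (Omega1 : measurableType d1) (Omega2 : measurableType d2)
    (Pr1 : probability Omega1 R) (Pr2 : probability Omega2 R)
    (P : A -> history A -> R) (x : history A)
    (Z1 : int -> Omega1 -> A) (Z2 : int -> Omega2 -> A) :
  is_chain P x Pr1 Z1 -> is_chain P x Pr2 Z2 -> same_law Pr1 Z1 Pr2 Z2.
Proof.
move=> c1 c2; have [p1 x1 _] := c1; have [p2 x2 _] := c2.
pose G := [set E | exists (s : seq int) (B : set (seq A)),
  E = [set u : int -> A | B (map u s)]].
pose D := [set E : set (int -> A) | [/\
  measurable [set w | E (Z1^~ w)], measurable [set w | E (Z2^~ w)] &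
  Pr1 [set w | E (Z1^~ w)] = Pr2 [set w | E (Z2^~ w)]]].
suff GD : <<s G >> `<=` D.
  move=> E; rewrite /path_measurable => sE; have [//|_ _ ->//] := GD E _.
  move: E sE; apply: smallest_sub; first exact: smallest_sigma_algebra.
  move=> _ [i [B ->]]; apply: sub_sigma_algebra; exists [:: i], [set t | B (head (x 0%N) t)].
  by [].
apply: lambda_system_subset => //.
- move=> _ _ [s1 [B1 ->]] [s2 [B2 ->]].
  (* Two cylinders intersect in a cylinder over the concatenated list of times. *)
  exists (s1 ++ s2), [set t | B1 (take (size s1) t) /\ B2 (drop (size s1) t)].
  apply/seteqP; split=> u /=; rewrite map_cat take_size_cat ?size_map//;
  by rewrite drop_size_cat ?size_map.
- apply/dynkin_lambda_system; split=> /=.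
  + split; [exact: measurableT|exact: measurableT|].
    exact: etrans (probability_setT Pr1) (esym (probability_setT Pr2)).
  + move=> E [mE1 mE2 E12]; split; [exact: measurableC|exact: measurableC|].
    have := probability_setC Pr1 mE1; rewrite E12 -(probability_setC Pr2 mE2).
    exact.
  + move=> F tF DF; split.
    * rewrite (_ : [set _ | _] = \bigcup_k [set w | F k (Z1^~ w)])//.
      by apply: bigcupT_measurable => k; have [] := DF k.
    * rewrite (_ : [set _ | _] = \bigcup_k [set w | F k (Z2^~ w)])//.
      by apply: bigcupT_measurable => k; have [] := DF k.
    have disj (Om : Type) (X : Om -> int -> A) :
        trivIset setT (fun k => [set w | F k (X w)]).
      by apply/trivIsetP => i j _ _ /(trivIsetP.1 tF i j I I) FF0;
        apply/seteqP; split=> w //= [Fi Fj]; rewrite -[False]/(set0 (X w)) -FF0.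
    have e1 : Pr1 (\bigcup_k [set w | F k (Z1^~ w)]) =
        (\sum_(0 <= k <oo) Pr1 [set w | F k (Z1^~ w)])%E.
      rewrite measure_bigcup//; last by move=> k _; have [] := DF k.
      by apply: eq_eseriesl => k; rewrite in_setT.
    have e2 : Pr2 (\bigcup_k [set w | F k (Z2^~ w)]) =
        (\sum_(0 <= k <oo) Pr2 [set w | F k (Z2^~ w)])%E.
      rewrite measure_bigcup//; last by move=> k _; have [] := DF k.
      by apply: eq_eseriesl => k; rewrite in_setT.
    apply: etrans e1 (etrans _ (esym e2)).
    by apply: eq_eseriesr => k _; have [] := DF k.
- move=> _ [s [B ->]]; split; [exact: map_process_measurable|exact: map_process_measurable|].
  (* A crude bound, a sum instead of a maximum: [N] exceeds every nonnegative time in [s], so the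
     first [N] letters and the past decide the cylinder. *)
  pose N := (\sum_(i <- s) if i is Posz k then k.+1 else 0)%N.
  have sN k : Posz k \in s -> (k < N)%N.
    move=> ks; rewrite /N (big_rem _ ks)/=; exact: leq_addr.
  (* Rebuilds a path from its first [N] letters. They are stored most recent first, so the letter of
     time [k] sits at position [N - (k+1)]. *)
  pose past t (i : int) : A :=
    match i with Posz k => nth (x 0%N) t (N - k.+1) | Negz k => x k end.
  have glue (u : int -> A) : (forall k, u (Negz k) = x k) ->
      map u s = map (past (word N (u \o Posz))) s.
    move=> ux; apply/eq_in_map => -[k ks|k _]; last exact: ux.
    have kN := sN k ks; rewrite /= nth_word; last by rewrite ltn_subrL/= (leq_trans _ kN).
    by rewrite /= subnSK// subKn// ltnW.
  have ae (dd : measure_display) (Om : measurableType dd) (Pr : probability Om R)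
      (Z : int -> Om -> A) : is_process Z ->
      (forall k : nat, {ae Pr, forall w, Z (Negz k) w = x k}) ->
      Pr [set w | B (map (Z^~ w) s)] =
      Pr [set w | B (map (past (word N (fun k => Z k%:Z w))) s)].
    move=> pZ Zx; apply: measure_ae_eq.
    - exact: map_process_measurable.
    - exact: (word_process_measurable N [set t | B (map (past t) s)]).
    by have := ae_foralln Zx; apply: filterS => w Zw /=; rewrite (glue (Z^~ w) Zw).
  rewrite (ae _ _ _ _ p1 x1) (ae _ _ _ _ p2 x2).
  (* As [N]-tuples, these words range over a finite type, where equal point probabilities
     suffice. *)
  have szN (u : nat -> A) : size (word N u) == N by rewrite size_word.
  pose tw (u : nat -> A) : N.-tuple A := Tuple (szN u).
  have twE (Om : Type) (X : Om -> nat -> A) (t : N.-tuple A) :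
     [set w | tw (X w) = t] = [set w | word (size t) (X w) = t].
    by apply/seteqP; rewrite size_tuple; split=> w /= => [<-//|wt]; exact: val_inj.
  apply: (@finite_law_eq _ _ _ _ _ _ _ _ (fun w => tw (fun k => Z1 k%:Z w))
    (fun w => tw (fun k => Z2 k%:Z w)) _ _ _ [set t : N.-tuple A | B (map (past t) s)]) => t.
  + by rewrite twE; exact: (word_process_measurable _ [set tval t]).
  + by rewrite twE; exact: (word_process_measurable _ [set tval t]).
  + by rewrite !twE; exact: (word_law c1 c2).
Qed.

(** * A process with prescribed word probabilities *)

Section nested_intervals.
Context (R : realType) (T : finType) (K : seq T -> T -> R).
Hypothesis K_ge0 : forall s t, 0 <= K s t.
Hypothesis K_sum1 : forall s, \sum_t K s t = 1.

(** Letters are ordered by [enum_rank]; the values of [cumul s] are the endpoints, rescaled to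
    [0, 1], of the successive child intervals of [s]. *)
Definition cumul s (j : nat) : R := \sum_(u : T | (enum_rank u < j)%N) K s u.

(* The word [s] is realised by the interval [[ilow s, ilow s + iwidth s[]. *)
Fixpoint iwidth s : R := if s is t :: s' then iwidth s' * K s' t else 1.

Fixpoint ilow s : R :=
  if s is t :: s' then ilow s' + iwidth s' * cumul s' (enum_rank t) else 0.

Definition inter s : set R := `[ilow s, ilow s + iwidth s[.

Lemma iwidth_ge0 s : 0 <= iwidth s.
Proof. by elim: s => [|t s IH] /=; [exact: ler01|exact: mulr_ge0]. Qed.

Lemma cumul_ge0 s j : 0 <= cumul s j. Proof. exact: sumr_ge0. Qed.

Lemma cumul_homo s : {homo cumul s : i j / (i <= j)%N >-> i <= j}.
Proof.
move=> i j ij; rewrite /cumul [leLHS]big_mkcond [leRHS]big_mkcond.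
apply: ler_sum => v _; case: ifPn => [vi|_]; last by case: ifP.
by rewrite (leq_trans vi).
Qed.

Lemma cumul_rankS s (t : T) :
  cumul s (enum_rank t).+1 = cumul s (enum_rank t) + K s t.
Proof.
rewrite /cumul (bigD1 t)/= ?ltnS// addrC; congr (_ + _).
apply: eq_bigl => u; rewrite ltnS [RHS]ltn_neqAle andbC; congr (_ && _).
by congr negb; apply/eqP/eqP => [->|/val_inj/enum_rank_inj].
Qed.

Lemma cumul_card s : cumul s #|T| = 1.
Proof. by rewrite -(K_sum1 s); apply: eq_bigl => u; rewrite ltn_ord. Qed.

Lemma inter_nil w : 0 <= w < 1 -> inter [::] w.
Proof. by rewrite /inter /= add0r in_itv. Qed.

(** The two bounds are consecutive values of one nondecreasing function of the rank; nesting,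
    disjointness and covering of the child intervals follow by monotonicity. *)
Lemma inter_cons t s w : inter (t :: s) w <->
  ilow s + iwidth s * cumul s (enum_rank t) <= w <
  ilow s + iwidth s * cumul s (enum_rank t).+1.
Proof. by rewrite /inter /= in_itv/= cumul_rankS mulrDr addrA. Qed.

Lemma iscale_homo s i j : (i <= j)%N ->
  ilow s + iwidth s * cumul s i <= ilow s + iwidth s * cumul s j.
Proof. by move=> ij; rewrite lerD2l ler_wpM2l ?iwidth_ge0 ?cumul_homo. Qed.

Lemma inter_cons_sub t s : inter (t :: s) `<=` inter s.
Proof.
move=> w /inter_cons/andP[lw wl]; rewrite /inter /= in_itv/=; apply/andP; split.
  by apply: le_trans lw; rewrite lerDl mulr_ge0 ?iwidth_ge0 ?cumul_ge0.
apply: (lt_le_trans wl).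
by have := iscale_homo s (ltn_ord (enum_rank t)); rewrite cumul_card mulr1.
Qed.

Lemma inter_cons_inj t u s w : inter (t :: s) w -> inter (u :: s) w -> t = u.
Proof.
have sep v v' : (enum_rank v < enum_rank v')%N ->
    inter (v :: s) w -> inter (v' :: s) w -> False.
  move=> vv' /inter_cons/andP[_ wv] /inter_cons/andP[v'w _].
  by have := lt_le_trans wv (le_trans (iscale_homo s vv') v'w); rewrite ltxx.
case: (ltngtP (enum_rank t) (enum_rank u)) => [tu|ut|/val_inj/enum_rank_inj//].
  by move=> wt wu; case: (sep _ _ tu wt wu).
by move=> wt wu; case: (sep _ _ ut wu wt).
Qed.

Lemma inter_cons_cover s w : inter s w -> exists t, inter (t :: s) w.
Proof.
rewrite /inter /= in_itv/= => /andP[lw wl].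
have exj : exists j, w < ilow s + iwidth s * cumul s j.
  by exists #|T|; rewrite cumul_card mulr1.
(* The least index whose endpoint exceeds [w] is not 0, since the endpoint of index 0 is [ilow s];
   its predecessor is the rank of the wanted letter. *)
case: (ex_minnP exj) => -[|j] wj minj.
  move: wj; rewrite /cumul big_pred0 => [|//]; rewrite mulr0 addr0.
  by rewrite ltNge lw.
have jT : (j < #|T|)%N by apply: minj; rewrite cumul_card mulr1.
exists (enum_val (Ordinal jT)); apply/inter_cons; rewrite enum_valK /= wj andbT.
by rewrite leNgt; apply/negP => /minj; rewrite ltnn.
Qed.

(** Sends every real into [0, 1[, so that letters are defined at all sample points; it moves only a
    null set of the uniform law. *)
Definition clip (w : R) : R := if (0 <= w) && (w < 1) then w else 0.

Lemma clip_itv w : 0 <= clip w < 1.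
Proof. by rewrite /clip; case: ifPn => // _; rewrite lexx ltr01. Qed.

(** The word is built together with the proof that its interval contains the point, because the next
    letter is obtained from that proof. *)
Fixpoint located (w : R) n : {s : seq T | inter s (clip w)} :=
  if n is n'.+1 then
    let: exist s sw := located w n' in
    let: exist t tw := cid (inter_cons_cover sw) in exist _ (t :: s) tw
  else exist _ [::] (inter_nil (clip_itv w)).

Definition letter (n : nat) (w : R) : T := 
  let: exist s sw := located w n in projT1 (cid (inter_cons_cover sw)).

Lemma word_letter n w : word n (letter^~ w) = sval (located w n).
Proof.
elim: n => //= n ->; rewrite /letter; case: (located w n) => s sw /=.
by case: (cid _).
Qed.

(** Sibling intervals are disjoint and children lie in their parents, so only one word of each
    length has the point in its interval. *)
Lemma word_letterP n w s :
  word n (letter^~ w) = s <-> size s = n /\ inter s (clip w).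
Proof.
split=> [<-|[<-]]; first by rewrite size_word word_letter; case: (located w n).
elim: s => //= t s IH ts; have sw := inter_cons_sub ts.
rewrite IH//; congr cons.
have := IH sw; rewrite word_letter /letter; case: (located w (size s)) => s' s'w /= s's.
by case: (cid _) => u /= us; subst s'; exact: (inter_cons_inj us ts).
Qed.

Definition unit_prob : probability (measurableTypeR R) R := uniform_prob (@ltr01 R).

Lemma unit_probE (B : set R) : measurable B -> B `<=` `[0, 1[ ->
  unit_prob B = lebesgue_measure B.
Proof.
move=> mB B01; rewrite /unit_prob /= /uniform_prob.
rewrite (eq_integral (fun=> 1%E)) ?integral_cst ?mul1e// => w /set_mem/B01.
rewrite /= in_itv/= /uniform_pdf => /andP[w0 /ltW w1].
by rewrite w0 w1 subr0 invr1.
Qed.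

Lemma clip_preimage_measurable (B : set R) :
  measurable B -> measurable (clip @^-1` B).
Proof.
move=> mB; rewrite -[X in measurable X]setTI.
apply: measurable_fun_if => //=.
by apply: measurable_and => //; [exact: measurable_fun_ler|exact: measurable_fun_ltr].
Qed.

Lemma clip_preimage_prob (B : set R) : measurable B -> B `<=` `[0, 1[ ->
  unit_prob (clip @^-1` B) = lebesgue_measure B.
Proof.
move=> mB B01; rewrite -unit_probE//.
apply: measure_ae_eq => //; first exact: clip_preimage_measurable.
exists (~` `[0, 1[%classic); split; first exact: measurableC.
  rewrite probability_setC// unit_probE// lebesgue_measure_itv/= lte_fin ltr01.
  by rewrite oppr0 adde0 subee.
apply: subsetC => w; rewrite /= in_itv/= => w01.
by rewrite /clip w01.
Qed.

Lemma inter_measurable s : measurable (inter s).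
Proof. exact: measurable_itv. Qed.

Lemma inter_sub01 s : inter s `<=` `[0, 1[.
Proof.
elim: s => [|t s IH w /inter_cons_sub/IH//].
by rewrite /inter /= add0r.
Qed.

Lemma word_letter_measurable n s :
  measurable [set w : measurableTypeR R | word n (letter^~ w) = s].
Proof.
have [<-|ns] := eqVneq (size s) n.
  rewrite (_ : [set _ | _] = clip @^-1` (inter s)).
    exact: (clip_preimage_measurable (inter_measurable s)).
  by apply/seteqP; split=> w /=; rewrite word_letterP; [case|split].
rewrite (_ : [set _ | _] = set0)//; apply/seteqP; split=> w //= ws.
by rewrite -ws size_word eqxx in ns.
Qed.

Lemma word_letter_prob s :
  unit_prob [set w | word (size s) (letter^~ w) = s] = (iwidth s)%:E.
Proof.
rewrite (_ : [set _ | _] = clip @^-1` (inter s)); last first.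
  by apply/seteqP; split=> w /=; rewrite word_letterP; [case|split].
rewrite clip_preimage_prob; [|exact: inter_measurable|exact: inter_sub01].
rewrite lebesgue_measure_itv/= lte_fin ltrDl -EFinD addrAC subrr add0r.
(* The interval is empty when its width is not positive; being nonnegative, the width is then 0. *)
case: ltP => // w0; congr (_%:E); apply/esym/le_anti.
by rewrite w0 iwidth_ge0.
Qed.

End nested_intervals.

(** * Chains obtained by projecting the letters *)

Section projected_chain.
Context (R : realType) (T A : finType) (K : seq T -> T -> R).
Hypothesis K_ge0 : forall s t, 0 <= K s t.
Hypothesis K_sum1 : forall s, \sum_t K s t = 1.

Local Notation L := (letter K_sum1).
Local Notation Q := (unit_prob R).

Lemma word_letter_preimage_measurable n (B : set (seq T)) :
  measurable [set w : measurableTypeR R | B (word n (L^~ w))].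
Proof.
have szn (w : R) : size (word n (L^~ w)) == n by rewrite size_word.
apply: (@finite_preimage_measurable _ (measurableTypeR R) (n.-tuple T)
  (fun w => Tuple (szn w)) _ [set t : n.-tuple T | B t]) => t.
rewrite (_ : [set _ | _] = [set w : R | word n (L^~ w) = t]).
  exact: word_letter_measurable.
by apply/seteqP; split=> w /= => [<-//|wt]; exact: val_inj.
Qed.

Lemma letter_measurable n (B : set T) :
  measurable [set w : measurableTypeR R | B (L n w)].
Proof.
rewrite (_ : [set _ | _] = [set w | exists t s, B t /\ word n.+1 (L^~ w) = t :: s]).
  exact: (word_letter_preimage_measurable _ [set s' | exists t s, B t /\ s' = t :: s]).
apply/seteqP; split=> w /= => [BL|[t [s [Bt [-> _]]]]//].
by exists (L n w), (word n (L^~ w)).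
Qed.

Lemma word_letter_split s (E : set (measurableTypeR R)) : measurable E ->
  Q ([set w | word (size s) (L^~ w) = s] `&` E) =
  (\sum_t Q ([set w | word (size s).+1 (L^~ w) = t :: s] `&` E))%E.
Proof.
move=> mE; rewrite (@measure_finite_partition _ _ _ Q _ (L (size s))); last first.
- by move=> t; exact: (letter_measurable _ [set t]).
- by apply: measurableI => //; exact: word_letter_measurable.
apply: eq_bigr => t _; congr (Q _); apply/seteqP; split=> w /=.
  by move=> [[-> ?] ->].
by move=> [[-> ->] ?].
Qed.

Context (P : A -> history A -> R) (x : history A) (f : T -> A).
Hypothesis K_proj : forall s a,
  \sum_(t | f t == a) K s t = P a (prepend (map f s) x).

Definition projected (i : int) (w : measurableTypeR R) : A :=
  match i with Posz n => f (L n w) | Negz k => x k end.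

(** A lumping argument: by [K_proj], the law of the next projected letter given the full word
    depends only on the projected word. Summing over the full words [t] above [s] gives the product
    formula of [is_chainP]. *)
Lemma projected_chain : is_chain P x Q projected.
Proof.
have pU : is_process projected.
  case=> [n|k] B; first exact: (letter_measurable n (f @^-1` B)).
  by rewrite -[X in measurable X]/(cst (x k) @^-1` B) preimage_cst; case: ifP.
apply/is_chainP => //; first by move=> k; exact: aeW.
move=> a s; set n := size s.
have szn (w : R) : size (word n (L^~ w)) == n by rewrite size_word.
pose X w : n.-tuple T := Tuple (szn w).
have mX t : measurable [set w : measurableTypeR R | X w = t].
  rewrite (_ : [set _ | _] = [set w : R | word n (L^~ w) = t]).
    exact: word_letter_measurable.
  by apply/seteqP; split=> w /= => [<-//|wt]; exact: val_inj.
have wordU m w : word m (fun k => projected k%:Z w) = map f (word m (L^~ w)).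
  by rewrite map_word.
rewrite (@measure_finite_partition _ _ _ Q _ _ _ _ mX); last first.
  exact: (word_process_measurable _ [set a :: s]).
rewrite [in RHS](@measure_finite_partition _ _ _ Q _ _ _ _ mX); last first.
  exact: (word_process_measurable _ [set s]).
rewrite ge0_sume_distrl => [|t _]; last exact: measure_ge0.
apply: eq_bigr => t _.
have XtE : [set w | X w = t] = [set w : R | word (size t) (L^~ w) = t].
  by apply/seteqP; rewrite size_tuple; split=> w /= => [<-//|wt]; exact: val_inj.
under eq_set do rewrite wordU; under [in RHS]eq_set do rewrite wordU.
rewrite XtE !(setIC _ [set w : R | word _ _ = t]).
(* A full word that does not project to [s] contributes 0 to both sides. *)
have [ts|ts] := eqVneq (map f t) s; last first.
  have wt0 (B : set R) : (forall w, B w -> map f (word n (L^~ w)) = s) ->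
      Q ([set w : R | word (size t) (L^~ w) = t] `&` B) = 0%E.
    move=> Bs; rewrite (_ : _ `&` _ = set0) ?measure0//.
    apply/seteqP; split=> w //= []; rewrite size_tuple => wt /Bs.
    by rewrite wt => /eqP; rewrite (negbTE ts).
  by rewrite !wt0 ?mul0e// => w /= [].
rewrite word_letter_split; last first.
  exact: (word_letter_preimage_measurable _ [set s' | map f s' = a :: s]).
have -> : [set w : R | word (size t) (L^~ w) = t] `&`
    [set w | map f (word n (L^~ w)) = s] = [set w | word (size t) (L^~ w) = t].
  by apply/seteqP; split=> w //= [] //; rewrite size_tuple => wt; split; rewrite wt.
rewrite word_letter_prob// -ts -K_proj -EFinM mulr_sumr -sumEFin [RHS]big_mkcond.
apply: eq_bigr => v _.
case: ifPn => [/eqP fv|fv].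
  rewrite -[(_ * _)%R]/(iwidth K (v :: t)) -(word_letter_prob K_ge0 K_sum1); congr (Q _); apply/seteqP; split=> w /=.
    by case.
  by rewrite size_tuple => wt; split=> //; move: wt => [-> ->]; rewrite fv ts.
rewrite (_ : _ `&` _ = set0) ?measure0//; apply/seteqP; split=> w //= [].
by rewrite size_tuple => -[-> _] [/eqP]; rewrite (negbTE fv).
Qed.

End projected_chain.

(** * The maximal coupling *)

Section maximal_coupling.
Context (R : realType) (A : finType) (p q : A -> R).
Hypothesis p_ge0 : forall a, 0 <= p a.
Hypothesis q_ge0 : forall a, 0 <= q a.
Hypothesis p_sum1 : \sum_a p a = 1.
Hypothesis q_sum1 : \sum_a q a = 1.

Definition overlap a : R := Num.min (p a) (q a).

(* Since [x / 0 = 0], this is also correct when [p = q]: the second summand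
   then vanishes. *)
Definition maxcoupling (ab : A * A) : R :=
  overlap ab.1 *+ (ab.1 == ab.2) +
  (p ab.1 - overlap ab.1) * (q ab.2 - overlap ab.2) / (1 - \sum_a overlap a).

Let excess_p a : 0 <= p a - overlap a.
Proof. by rewrite subr_ge0 ge_min lexx. Qed.

Let excess_q a : 0 <= q a - overlap a.
Proof. by rewrite subr_ge0 ge_min lexx orbT. Qed.

Let sum_excess_p : \sum_a (p a - overlap a) = 1 - \sum_a overlap a.
Proof. by rewrite sumrB p_sum1. Qed.

Let sum_excess_q : \sum_a (q a - overlap a) = 1 - \sum_a overlap a.
Proof. by rewrite sumrB q_sum1. Qed.

Lemma maxcoupling_ge0 ab : 0 <= maxcoupling ab.
Proof.
apply: addr_ge0; first by rewrite mulrn_wge0// le_min p_ge0 q_ge0.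
by rewrite !mulr_ge0// invr_ge0 -sum_excess_p sumr_ge0.
Qed.

Let overlap1_excess : 1 - \sum_a overlap a = 0 ->
  forall a, p a - overlap a = 0 /\ q a - overlap a = 0.
Proof.
move=> e0 a; split.
  by have /psumr_eq0P := etrans sum_excess_p e0; apply.
by have /psumr_eq0P := etrans sum_excess_q e0; apply.
Qed.

(** The diagonal contributes [overlap a]. The excesses of [q] add up to the denominator, so the
    product term supplies the missing [p a - overlap a]; if the denominator is 0, this excess
    vanishes. *)
Lemma maxcoupling_fst a : \sum_b maxcoupling (a, b) = p a.
Proof.
rewrite big_split/= (bigD1 a)//= eqxx big1 ?addr0 => [|b]; last first.
  by rewrite eq_sym => /negbTE ->.
rewrite -mulr_suml -mulr_sumr sum_excess_q.
have [e0|e0] := eqVneq (1 - \sum_a overlap a) 0; last by rewrite mulfK// subrKC.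
by rewrite (overlap1_excess e0 a).1 !mul0r addr0; apply/esym/subr0_eq;
  exact: (overlap1_excess e0 a).1.
Qed.

Lemma maxcoupling_snd b : \sum_a maxcoupling (a, b) = q b.
Proof.
rewrite big_split/= (bigD1 b)//= eqxx big1 ?addr0 => [|a /negbTE ->//].
rewrite -mulr_suml -mulr_suml sum_excess_p mulrAC.
have [e0|e0] := eqVneq (1 - \sum_a overlap a) 0; last by rewrite divff// mul1r subrKC.
by rewrite (overlap1_excess e0 b).2 mulr0 addr0; apply/esym/subr0_eq;
  exact: (overlap1_excess e0 b).2.
Qed.

Lemma maxcoupling_sum1 : \sum_ab maxcoupling ab = 1.
Proof.
rewrite (eq_bigr (fun ab => maxcoupling (ab.1, ab.2))) => [|[]//].
rewrite -(pair_bigA _ (fun a b => maxcoupling (a, b)))/= -p_sum1.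
by apply: eq_bigr => a _; exact: maxcoupling_fst.
Qed.

(** The diagonal carries at least [overlap a], which is at least [c * q a] because [c <= 1]; these
    bounds sum to [c]. *)
Lemma maxcoupling_agree c : 0 <= c <= 1 -> (forall a, c * q a <= p a) ->
  c <= \sum_(ab | ab.1 == ab.2) maxcoupling ab.
Proof.
move=> /andP[c0 c1] cq.
rewrite (eq_bigr (fun ab => maxcoupling (ab.1, ab.2))) => [|[]//].
rewrite -(pair_big_dep xpredT (fun a b => a == b) (fun a b => maxcoupling (a, b)))/=.
rewrite -[c]mulr1 -q_sum1 mulr_sumr; apply: ler_sum => a _.
under eq_bigl do rewrite eq_sym.
rewrite big_pred1_eq /maxcoupling/= eqxx mulr1n.
apply: ler_wpDr.
  by rewrite !mulr_ge0// invr_ge0 -sum_excess_p sumr_ge0.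
by rewrite le_min cq ler_piMl.
Qed.

End maximal_coupling.

(** * Domination by the renewal chain *)

Section renewal.
Context (R : realType) (gamma : nat -> R).
Hypothesis gamma01 : forall i, 0 <= gamma i <= 1.
Hypothesis gamma_mono : nonincreasing_seq gamma.

(** The transition operator of the renewal chain, acting on functions of the state. *)
Definition renewal_step (h : nat -> R) : nat -> R :=
  fun i => (1 - gamma i) * h i.+1 + gamma i * h 0%N.

(* [hit0 m i] is the probability that the renewal chain started at [i] is at
   [0] at time [m]. *)
Definition hit0 m : nat -> R := iter m renewal_step (fun i => (i == 0%N)%:R).

(** A higher state falls to 0 with smaller probability, and by induction 0 is the state with the
    largest value while [hit0 m] decreases along the upward moves. *)
Lemma hit0_noninc m : nonincreasing_seq (hit0 m).
Proof.
elim: m => [|m IH] i j ij; rewrite /hit0 /=.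
  by case: i ij => [|i]; case: j => [|j]//= _; rewrite ?lexx ?ler01.
rewrite -/(hit0 m) /renewal_step.
have gij := gamma_mono ij.
have hij : hit0 m j.+1 <= hit0 m i.+1 by apply: IH.
have h0 : hit0 m i.+1 <= hit0 m 0 by apply: IH.
have /andP[g0 g1] := gamma01 j.
nra.
Qed.

(** The left side averages the values of [hit0 m] at 1 and 0, of which the second is the larger.
    This absorbs the shift between time [n] and the [n+1] letters drawn by then. *)
Lemma hit0_time_noninc m : hit0 m.+1 0 <= hit0 m 0.
Proof.
rewrite /hit0 /= -/(hit0 m) /renewal_step.
have h0 : hit0 m 1 <= hit0 m 0 by apply: hit0_noninc.
have /andP[g0 g1] := gamma01 0.
nra.
Qed.

Section lower_bound.
Context (d : measure_display) (Omega : measurableType d)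
  (Pr : probability Omega R) (S : nat -> Omega -> nat).
Hypothesis hS : is_markov_chain (renewal_trans gamma) 0 Pr S.

Let path n (s : nat -> nat) : set Omega :=
  [set w | forall k : nat, (k <= n)%N -> S k w = s k].

Let state_measurable n j : measurable [set w | S n w = j].
Proof. by have [pS _ _] := hS; exact: (pS n [set j]). Qed.

Let path_measurable n s : measurable (path n s).
Proof.
rewrite (_ : path n s = \bigcap_(k in [set k | (k <= n)%N]) [set w | S k w = s k]).
  by apply: bigcap_measurable => //; exists 0%N; rewrite /=.
by apply/seteqP; split=> w /= ws k; apply: ws.
Qed.

(** Induction on the remaining time [m], applying the Markov property to the path extended by one
    state. For a lower bound it is enough to follow the moves to [s n + 1] and to 0. *)
Lemma path_hit0 m n s :
  (Pr (path n s) * (hit0 m (s n))%:E <=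
   Pr (path n s `&` [set w | S (n + m)%N w = 0%N]))%E.
Proof.
elim: m n s => [|m IH] n s.
  rewrite addn0 /hit0 /=; case: eqP => [s0|_]; last by rewrite mule0.
  rewrite mule1 (_ : _ `&` _ = path n s)//.
  by apply/seteqP; split=> w => [[]//|ws]; split=> //=; rewrite -s0; apply: ws.
pose ext j k := if k == n.+1 then j else s k.
have extE j : path n.+1 (ext j) = path n s `&` [set w | S n.+1 w = j].
  apply/seteqP; split=> w /= => [ws|[ws <-] k].
    split=> [k kn|]; last by rewrite ws// /ext eqxx.
    by rewrite ws ?leqW// /ext ltn_eqF.
  by rewrite /ext leq_eqVlt; case: eqP => [->//|_ /=]; exact: ws.
have stepE j : Pr (path n.+1 (ext j)) =
    (Pr (path n s) * (renewal_trans gamma (s n) j)%:E)%E.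
  have [_ _ step] := hS; have := step n s j; rewrite -/(path n s) /cond_prob.
  rewrite extE setIC.
  have [p0 _|pn0] := eqVneq (Pr (path n s)) 0%E.
    rewrite p0 mul0e; apply: (subset_measure0 _ _ (@subIsetl _ _ _) p0) => //.
    exact: measurableI.
  rewrite /= lt0e pn0 measure_ge0 => /(_ isT) <-.
  rewrite -[X in (X * _)%E]fineK ?fin_num_measure// -EFinM mulrC divfK.
    by rewrite fineK// fin_num_measure//; exact: measurableI.
  by rewrite fine_eq0// fin_num_measure.
have up : path n.+1 (ext (s n).+1) `&` [set w | S (n.+1 + m)%N w = 0%N]
   `|` path n.+1 (ext 0%N) `&` [set w | S (n.+1 + m)%N w = 0%N]
   `<=` path n s `&` [set w | S (n + m.+1)%N w = 0%N].
  by rewrite !extE addnS => w [] [[? _] ?].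
apply: (le_trans _ (le_measure Pr _ _ up)); rewrite ?inE; last 2 first.
- by apply: measurableU; apply: measurableI.
- exact: measurableI.
rewrite measureU; [|exact: measurableI|exact: measurableI|]; last first.
  by rewrite !extE; apply/seteqP; split=> w //= [] [] [_ ->] _ [] [].
apply: (le_trans _ (leeD (IH _ _) (IH _ _))).
rewrite !stepE /ext eqxx /renewal_trans !eqxx/= -!muleA -muleDr ?fin_num_measure//.
Qed.

Lemma gamma_star_ge n : ((hit0 n 0)%:E <= gamma_star Pr S n)%E.
Proof.
have := path_hit0 n 0 (fun=> 0%N); rewrite add0n.
have -> : Pr (path 0 (fun=> 0%N)) = 1%E.
  rewrite -(probability_setT Pr); apply: measure_ae_eq => //.
  have [_ S0 _] := hS; apply: filterS S0 => w S0w; split=> // _ k.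
  by rewrite leqn0 => /eqP ->.
rewrite mul1e => /le_trans; apply; apply: le_measure; rewrite ?inE//.
exact: measurableI.
Qed.

End lower_bound.
End renewal.

(** Counts agreeing letters since the last mismatch among drawn letters only: the empty word has
    value 0, matching the start of the renewal chain at 0, even if the given pasts agree. *)
Definition agreement (A : eqType) (s : seq (A * A)) : nat :=
  find [pred ab | ab.1 != ab.2] s.
Arguments agreement : simpl never.

Lemma agreement_cons (A : eqType) (ab : A * A) s :
  agreement (ab :: s) = if ab.1 == ab.2 then (agreement s).+1 else 0%N.
Proof. by rewrite /agreement /=; case: eqP. Qed.

Lemma eq_past_agreement (A : finType) (s : seq (A * A)) (x y : history A) :
  eq_past (agreement s) (prepend (unzip1 s) x) (prepend (unzip2 s) y).
Proof.
move=> k ks; have ksz : (k < size s)%N by apply: leq_trans ks (find_size _ _).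
rewrite /prepend !size_map ksz.
rewrite !(nth_map (x 0%N, x 0%N))//.
by have /= /negbFE/eqP := before_find (x 0%N, x 0%N) ks.
Qed.

(** * The coupled pair and its mismatch probability *)

Section coupled_chains.
Context (R : realType) (A : finType) (P : A -> history A -> R)
  (gamma : nat -> R) (x y : history A).
Hypothesis hP : transition_probabilities P.
Hypothesis gamma01 : forall i, 0 <= gamma i <= 1.
Hypothesis gamma_mono : nonincreasing_seq gamma.
Hypothesis hratio : forall (a : A) (m : nat) (x y : history A),
  eq_past m x y -> P a x >= (1 - gamma m) * P a y.

Definition coupled_kernel (s : seq (A * A)) : A * A -> R :=
  maxcoupling (P^~ (prepend (unzip1 s) x)) (P^~ (prepend (unzip2 s) y)).

Let P_ge0 z a : 0 <= P a z. Proof. by have /andP[] := hP.1 a z. Qed.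
Let P_sum1 z : \sum_a P a z = 1. Proof. exact: hP.2. Qed.

Lemma coupled_kernel_ge0 s ab : 0 <= coupled_kernel s ab.
Proof. exact: maxcoupling_ge0. Qed.

Lemma coupled_kernel_sum1 s : \sum_ab coupled_kernel s ab = 1.
Proof. exact: maxcoupling_sum1. Qed.

Lemma coupled_kernel_fst s a :
  \sum_(ab | ab.1 == a) coupled_kernel s ab = P a (prepend (unzip1 s) x).
Proof.
rewrite -(maxcoupling_fst (P_sum1 _) (P_sum1 (prepend (unzip2 s) y))).
transitivity (\sum_(i | i == a) \sum_b coupled_kernel s (i, b)).
  by rewrite pair_big/=; apply: eq_big => [ab|[]//]; rewrite andbT.
by rewrite big_pred1_eq.
Qed.

Lemma coupled_kernel_snd s b :
  \sum_(ab | ab.2 == b) coupled_kernel s ab = P b (prepend (unzip2 s) y).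
Proof.
rewrite -(maxcoupling_snd (P_sum1 (prepend (unzip1 s) x)) (P_sum1 _)).
transitivity (\sum_a \sum_(j | j == b) coupled_kernel s (a, j)).
  by rewrite pair_big/=; apply: eq_big => [|[]].
by apply: eq_bigr => a _; rewrite big_pred1_eq.
Qed.

Lemma coupled_kernel_agree s :
  1 - gamma (agreement s) <= \sum_(ab | ab.1 == ab.2) coupled_kernel s ab.
Proof.
have /andP[g0 g1] := gamma01 (agreement s).
apply: maxcoupling_agree => //; first by apply/andP; split; lra.
by move=> a; apply: hratio; exact: eq_past_agreement.
Qed.

Local Notation L := (letter coupled_kernel_sum1).
Local Notation Q := (unit_prob R).

(** The agreement grows by one with probability at least [1 - gamma] and otherwise drops to 0. Since
    [hit0 m] is largest at 0, lowering the growth probability to exactly [1 - gamma] can only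
    increase the mean. *)
Lemma hit0_renewal_le m s :
  \sum_ab coupled_kernel s ab * hit0 gamma m (agreement (ab :: s)) <=
  hit0 gamma m.+1 (agreement s).
Proof.
under eq_bigr do rewrite agreement_cons.
rewrite (bigID (fun ab => ab.1 == ab.2))/=.
rewrite (eq_bigr (fun ab => coupled_kernel s ab * hit0 gamma m (agreement s).+1)); last first.
  by move=> ab ->.
rewrite -mulr_suml.
rewrite [X in _ + X](eq_bigr (fun ab => coupled_kernel s ab * hit0 gamma m 0)); last first.
  by move=> ab /negbTE ->.
rewrite -mulr_suml.
have := coupled_kernel_sum1 s; rewrite (bigID (fun ab => ab.1 == ab.2))/=.
have := coupled_kernel_agree s.
move: (\sum_(ab | ab.1 == ab.2) _) (\sum_(ab | ab.1 != ab.2) _) => p q.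
rewrite /hit0 /= -/(hit0 gamma m) /renewal_step => pge pq.
have h : hit0 gamma m (agreement s).+1 <= hit0 gamma m 0.
  exact: (hit0_noninc gamma01 gamma_mono).
nra.
Qed.

(** Induction on [m]: split according to the next pair of letters, then bound the average over that
    pair by [hit0_renewal_le]. *)
Lemma mismatch_after_word m s :
  (Q ([set w | word (size s) (L^~ w) = s] `&`
      [set w | agreement (word (size s + m) (L^~ w)) = 0%N]) <=
   (iwidth coupled_kernel s * hit0 gamma m (agreement s))%:E)%E.
Proof.
elim: m s => [|m IH] s; rewrite ?addn0 ?addnS.
  rewrite /hit0 /=; case: eqP => [_|s0].
    rewrite mulr1 -(word_letter_prob coupled_kernel_ge0 coupled_kernel_sum1).
    apply: le_measure; rewrite ?inE//.
      apply: measurableI.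
        exact: (word_letter_measurable coupled_kernel_ge0).
      exact: (word_letter_preimage_measurable coupled_kernel_ge0 _ _
  [set s | agreement s = 0%N]).
    exact: (word_letter_measurable coupled_kernel_ge0).
  rewrite (_ : _ `&` _ = set0) ?measure0 ?mulr0//.
  by apply/seteqP; split=> w // [/= ->] /s0.
rewrite (word_letter_split coupled_kernel_ge0); last first.
  exact: (word_letter_preimage_measurable coupled_kernel_ge0 _ _
  [set s | agreement s = 0%N]).
apply: (@le_trans _ _ (\sum_ab (iwidth coupled_kernel (ab :: s) *
    hit0 gamma m (agreement (ab :: s)))%:E)%E).
  by apply: lee_sum => ab _; exact: (IH (ab :: s)).
rewrite sumEFin lee_fin.
under eq_bigr do rewrite /= -mulrA.
rewrite -mulr_sumr ler_wpM2l ?iwidth_ge0//; last exact: hit0_renewal_le.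
exact: coupled_kernel_ge0.
Qed.

Lemma mismatch_prob n : (Q [set w | (L n w).1 <> (L n w).2] <=
  (hit0 gamma n 0)%:E)%E.
Proof.
(* The letter of time [n] is the head of the word of length [n+1]. *)
have := mismatch_after_word n.+1 [::]; rewrite [iwidth _ _]/= mul1r add0n => h.
apply: (@le_trans _ _ (hit0 gamma n.+1 0)%:E); last first.
  by rewrite lee_fin; exact: hit0_time_noninc.
apply: le_trans h; rewrite le_eqVlt; apply/orP; left; apply/eqP; congr (Q _).
apply/seteqP; split=> w.
  by move=> /= /eqP/negbTE ne; split=> //; rewrite /= agreement_cons ne.
by move=> [_ +] ?; rewrite /= agreement_cons; case: eqP.
Qed.

End coupled_chains.

Lemma mismatch_time0 (R : realType) (A : finType) (Omega : Type)
    (U V : int -> Omega -> A) (n : int) w :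
  mismatch_time R U V n w = 0%E <-> U n w <> V n w.
Proof.
split=> [T0 UV|UV]; last first.
  apply/le_anti/andP; split; first by apply: ereal_inf_lbound; exists 0%N; rewrite //= subr0.
  by apply: le_ereal_inf_tmp => _ [m _ <-]; rewrite lee_fin.
(* Without a mismatch at lag 0, the infimum runs over integers at least 1, or over the empty set
   with value [+oo]. *)
have : (1%:E <= mismatch_time R U V n w)%E.
  apply: le_ereal_inf_tmp => _ [[|m] /= ne <-].
    by move: ne; rewrite subr0.
  by rewrite lee_fin ler1n.
by rewrite T0 lee_fin ler10.
Qed.

Theorem proposition1 (R : realType) (A : finType)
  (P : A -> history A -> R) (gamma : nat -> R)
  (hP : transition_probabilities P)
  (gamma_mono : nonincreasing_seq gamma)
  (gamma_lim : gamma @ \oo --> (0 : R))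
  (gamma0 : gamma 0%N < 1)
  (hratio : forall (a : A) (m : nat) (x y : history A),
     eq_past m x y -> P a x >= (1 - gamma m) * P a y)
  (* the chains Z^x *)
  (d : history A -> measure_display)
  (Omega : forall x : history A, measurableType (d x))
  (Pr : forall x : history A, probability (Omega x) R)
  (Z : forall x : history A, int -> Omega x -> A)
  (hZ : forall x : history A, is_chain P x (Pr x) (Z x))
  (* the Markov chain S^(gamma) *)
  (dS : measure_display) (OmegaS : measurableType dS)
  (PrS : probability OmegaS R) (S : nat -> OmegaS -> nat)
  (hS : is_markov_chain (renewal_trans gamma) 0 PrS S) :
  forall x y : history A,
  exists (dW : measure_display) (W : measurableType dW)
         (Q : probability W R) (U V : int -> W -> A),
    is_coupling (Pr x) (Z x) (Pr y) (Z y) Q U V /\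
    forall n : nat,
      (Q [set w | mismatch_time R U V n%:Z w = 0%E] <= gamma_star PrS S n)%E.
Proof.
move=> x y.
have gamma01 i : 0 <= gamma i <= 1.
  (* A nonincreasing sequence stays above its limit, here 0. *)
  have gc : cvgn gamma by apply/cvg_ex; exists 0.
  have := nonincreasing_cvgn_ge gamma_mono gc i.
  rewrite (cvg_lim _ gamma_lim)// => -> /=.
  exact: le_trans (gamma_mono _ _ (leq0n i)) (ltW gamma0).
pose K1 := coupled_kernel_sum1 x y hP.
pose K0 := coupled_kernel_ge0 x y hP.
(* Both coordinates read the same sequence of pairs, each completed by its own past. *)
exists _, (measurableTypeR R), (unit_prob R),
  (projected K1 x fst), (projected K1 y snd).
have chU := projected_chain K0 K1 (coupled_kernel_fst x y hP).
have chV := projected_chain K0 K1 (coupled_kernel_snd x y hP).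
split; first split.
- case=> [n|k] B; last first.
    rewrite -[X in measurable X]/(cst (x k, y k) @^-1` B) preimage_cst.
    by case: ifP.
  exact: (letter_measurable K0 K1 n (fun ab => B (ab.1, ab.2))).
- exact: is_chain_same_law chU (hZ x).
- exact: is_chain_same_law chV (hZ y).
move=> n; apply: (le_trans _ (gamma_star_ge hS n)).
apply: (le_trans _ (mismatch_prob x y hP gamma01 gamma_mono hratio n)).
rewrite le_eqVlt; apply/orP; left; apply/eqP; congr (unit_prob R _).
by apply/seteqP; split=> w; [move/mismatch_time0|move=> ne; apply/mismatch_time0].
Qed.
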